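(* Let $0<\alpha\le\beta$, let $f:\mathbb{R}^n\to\mathbb{R}$ be a differentiable function that is $\beta$-smooth and $\alpha$-strongly convex, let $\kappa=\beta/\alpha$, and let $x^*$ be the minimizer of $f$. Let $x_0\in\mathbb{R}^n$ be arbitrary, and let $(x_k)_{k\ge 0}$, $(c_k)_{k\ge 0}$, $(R_k^2)_{k\ge 0}$ be the sequences generated from $x_0$ by the geometric descent scheme defined in the context. Then for every $k\ge 0$, $$x^*\in \mathrm{B}(c_k,R_k^2),\qquad R_{k+1}^2\le\left(1-\frac{1}{\sqrt{\kappa}}\right)R_k^2,$$ and thus $$|x^*-c_k|^2\le\left(1-\frac{1}{\sqrt{\kappa}}\right)^k R_0^2 .$$
   Context: Notation: $|\cdot|$ is the Euclidean norm on $\mathbb{R}^n$. For $x\in\mathbb{R}^n$ and a real number $s$, $\mathrm{B}(x,s)=\{y\in\mathbb{R}^n: |y-x|^2\le s\}$ (the second argument is the squared radius). Smoothness and strong convexity: $f$ being $\beta$-smooth and $\alpha$-strongly convex means that for all $x,y\in\mathbb{R}^n$, $$f(x)+\nabla f(x)^\top(y-x)+\frac{\alpha}{2}|y-x|^2\le f(y)\le f(x)+\nabla f(x)^\top(y-x)+\frac{\beta}{2}|y-x|^2 .$$ For $x\in\mathbb{R}^n$ put $x^+=x-\frac1\beta\nabla f(x)$ and $x^{++}=x-\frac1\alpha\nabla f(x)$. Line search: for $x,y\in\mathbb{R}^n$, $\mathtt{line\_search}(x,y)$ is the (unique) point minimizing $f$ over the set $\{x+t(y-x):t\in\mathbb{R}\}$.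 Enclosing ball of the intersection of two balls: given centers $x_A,x_B\in\mathbb{R}^n$ and squared radii $R_A^2,R_B^2$, the output center $c$ and squared radius $R^2$ are defined as follows. (1) If $|x_A-x_B|^2\ge|R_A^2-R_B^2|$ (and $x_A\ne x_B$), then $$c=\tfrac12(x_A+x_B)-\frac{R_A^2-R_B^2}{2|x_A-x_B|^2}(x_A-x_B),\qquad R^2=R_B^2-\frac{\left(|x_A-x_B|^2+R_B^2-R_A^2\right)^2}{4|x_A-x_B|^2}.$$ (2) Otherwise, if $|x_A-x_B|^2<R_A^2-R_B^2$, then $c=x_B$ and $R^2=R_B^2$. (3) Otherwise, $c=x_A$ and $R^2=R_A^2$ (this includes the degenerate case $x_A=x_B$, $R_A^2=R_B^2$, where the two balls coincide). Geometric descent scheme: given $x_0$, set $c_0=x_0^{++}$ and $R_0^2=\left(1-\frac1\kappa\right)\frac{|\nabla f(x_0)|^2}{\alpha^2}$. For each $k\ge0$ set $$x_{k+1}=\mathtt{line\_search}(c_k,x_k^+),$$ and let $c_{k+1}$ and $R_{k+1}^2$ be the output center $c$ and output squared radius $R^2$ that the three-case rule (1)–(3) defining the enclosing ball of the intersection of two balls assigns to the two balls $$\mathrm{B}\left(x_{k+1}^{++},\ \frac{|\nabla f(x_{k+1})|^2}{\alpha^2}\left(1-\frac1\kappa\right)\right)\quad\text{and}\quad \mathrm{B}\left(c_k,\ R_k^2-\frac{|\nabla f(x_{k+1})|^2}{\alpha^2\kappa}\right),$$ i.e. with $x_A=x_{k+1}^{++}$, $R_A^2=\frac{|\nabla f(x_{k+1})|^2}{\alpha^2}\left(1-\frac1\kappa\right)$,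 $x_B=c_k$, $R_B^2=R_k^2-\frac{|\nabla f(x_{k+1})|^2}{\alpha^2\kappa}$. *)

(* Defs.v *)
From HB Require Import structures.
From mathcomp Require Import all_boot all_order all_algebra.
From mathcomp Require Import all_classical all_reals all_analysis.

Set Implicit Arguments.
Unset Strict Implicit.
Unset Printing Implicit Defensive.

Import Order.TTheory GRing.Theory Num.Theory.
Import numFieldNormedType.Exports.

Local Open Scope classical_set_scope.
Local Open Scope ring_scope.

(* The library norm `|x| on 'rV[R]_n is the sup norm, hence dot and enorm.
   The induced topology, and so differentiability, is the same. *)
Definition dot (R : realType) (n : nat) (u v : 'rV[R]_n) : R :=
  (u *m v^T) 0 0.

Definition enorm (R : realType) (n : nat) (u : 'rV[R]_n) : R :=
  Num.sqrt (dot u u).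

(* s is the squared radius; it may be negative, and the ball is then empty. *)
Definition sqball (R : realType) (n : nat) (x : 'rV[R]_n) (s : R) :
    set 'rV[R]_n :=
  [set y | enorm (y - x) ^+ 2 <= s].

Definition grad (R : realType) (n : nat) (f : 'rV[R]_n -> R) (x : 'rV[R]_n) :
    'rV[R]_n :=
  \row_(i < n) 'D_(delta_mx 0 i) f x.

Definition smooth_strongly_convex (R : realType) (n : nat) (alpha beta : R)
    (f : 'rV[R]_n -> R) : Prop :=
  forall x y : 'rV[R]_n,
    f x + dot (grad f x) (y - x) + alpha / 2 * enorm (y - x) ^+ 2 <= f y /\
    f y <= f x + dot (grad f x) (y - x) + beta / 2 * enorm (y - x) ^+ 2.

(* grad_step beta f x is x^+ and grad_step alpha f x is x^++. *)
Definition grad_step (R : realType) (n : nat) (a : R) (f : 'rV[R]_n -> R)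
    (x : 'rV[R]_n) : 'rV[R]_n :=
  x - a^-1 *: grad f x.

Definition line (R : realType) (n : nat) (x y : 'rV[R]_n) : set 'rV[R]_n :=
  [set x + t *: (y - x) | t in [set: R]].

(* The minimizer of f over the line exists and is unique when f is strongly
   convex and differentiable; otherwise [get _ | _] may be an arbitrary point. *)
Definition line_search (R : realType) (n : nat) (f : 'rV[R]_n -> R)
    (x y : 'rV[R]_n) : 'rV[R]_n :=
  [get z | line x y z /\ forall w, line x y w -> f z <= f w].

(* Center and squared radius of a ball enclosing
   sqball xA RA2 `&` sqball xB RB2. *)
Definition enclosing_ball (R : realType) (n : nat)
    (xA : 'rV[R]_n) (RA2 : R) (xB : 'rV[R]_n) (RB2 : R) : 'rV[R]_n * R :=
  let d2 := enorm (xA - xB) ^+ 2 in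
  if (`|RA2 - RB2| <= d2) && (xA != xB) then
    (2^-1 *: (xA + xB) - ((RA2 - RB2) / (2 * d2)) *: (xA - xB),
     RB2 - (d2 + RB2 - RA2) ^+ 2 / (4 * d2))
  else if d2 < RA2 - RB2 then (xB, RB2)
  else (xA, RA2).

Record geometric_descent (R : realType) (n : nat) (alpha beta : R)
    (f : 'rV[R]_n -> R) (x0 : 'rV[R]_n)
    (x c : nat -> 'rV[R]_n) (R2 : nat -> R) : Prop := {
  gd_x0 : x 0%N = x0;
  gd_c0 : c 0%N = grad_step alpha f x0;
  gd_R0 : R2 0%N =
    (1 - 1 / (beta / alpha)) * (enorm (grad f x0) ^+ 2 / alpha ^+ 2);
  gd_xS : forall k : nat,
    x k.+1 = line_search f (c k) (grad_step beta f (x k));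
  gd_cRS : forall k : nat,
    (c k.+1, R2 k.+1) =
    enclosing_ball
      (grad_step alpha f (x k.+1))
      (enorm (grad f (x k.+1)) ^+ 2 / alpha ^+ 2 * (1 - 1 / (beta / alpha)))
      (c k)
      (R2 k - enorm (grad f (x k.+1)) ^+ 2 / (alpha ^+ 2 * (beta / alpha)))
}.

(* Main.v *)
(** Write [e = 1 / sqrt kappa].  The invariant is that [xstar] lies in the
    ball around [c k] of squared radius [R2 k - d] with
    [d = 2 / alpha * (f (x_k^+) - f xstar) >= 0].  Strong convexity and the
    decrease of a gradient step put [xstar] in both balls of the next step,
    each with its squared radius reduced by the same amount [d], and the
    enclosing-ball rule preserves such a common reduction.  With
    [G = |grad f (x_{k+1})|^2 / alpha^2], exact line search makes the gradient
    orthogonal to [x_{k+1} - c_k], so the centers are at squared distance at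
    least [G].  The ball centered at [l xA + (1 - l) xB] has squared radius at
    most [(1 - l) R2 k + G (l^2 - e^2)]; rule (1) minimizes over [l], and
    [l = e] gives the contraction. *)

Require Import Defs.
From HB Require Import structures.
From mathcomp Require Import all_boot all_order all_algebra.
From mathcomp Require Import all_classical all_reals all_analysis.
From mathcomp Require Import ring lra.

Set Implicit Arguments.
Unset Strict Implicit.
Unset Printing Implicit Defensive.

Import Order.TTheory GRing.Theory Num.Theory.
Import numFieldNormedType.Exports.

Local Open Scope classical_set_scope.
Local Open Scope ring_scope.

(** * Bilinear algebra of the Euclidean inner product *)

Lemma dotC (R : realType) n (u v : 'rV[R]_n) : dot u v = dot v u.
Proof. by rewrite /dot !mxE; apply: eq_bigr => i _; rewrite !mxE mulrC. Qed.

Lemma dotDl (R : realType) n (u v w : 'rV[R]_n) :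
  dot (u + v) w = dot u w + dot v w.
Proof. by rewrite /dot mulmxDl mxE. Qed.

Lemma dotZl (R : realType) n a (u w : 'rV[R]_n) : dot (a *: u) w = a * dot u w.
Proof. by rewrite /dot -scalemxAl mxE. Qed.

Lemma dotDr (R : realType) n (u v w : 'rV[R]_n) :
  dot w (u + v) = dot w u + dot w v.
Proof. by rewrite dotC dotDl !(dotC w). Qed.

Lemma dotZr (R : realType) n a (u w : 'rV[R]_n) : dot w (a *: u) = a * dot w u.
Proof. by rewrite dotC dotZl (dotC w). Qed.

Lemma dotNl (R : realType) n (u w : 'rV[R]_n) : dot (- u) w = - dot u w.
Proof. by rewrite -scaleN1r dotZl mulN1r. Qed.

Lemma dotNr (R : realType) n (u w : 'rV[R]_n) : dot w (- u) = - dot w u.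
Proof. by rewrite dotC dotNl (dotC w). Qed.

Definition dotE := (dotDl, dotDr, dotNl, dotNr, dotZl, dotZr).

Lemma dot_ge0 (R : realType) n (u : 'rV[R]_n) : 0 <= dot u u.
Proof.
by rewrite /dot mxE; apply: sumr_ge0 => i _; rewrite !mxE -expr2 sqr_ge0.
Qed.

Lemma dot_eq0 (R : realType) n (u : 'rV[R]_n) : (dot u u == 0) = (u == 0).
Proof.
apply/eqP/eqP => [|->]; last by rewrite /dot mul0mx mxE.
rewrite /dot mxE => /eqP; rewrite psumr_eq0 => [/allP u0|i _]; last first.
  by rewrite !mxE -expr2 sqr_ge0.
apply/rowP => i; have := u0 i (mem_index_enum i).
by rewrite !mxE mulf_eq0 orbb => /eqP.
Qed.

Lemma enorm_sqr (R : realType) n (u : 'rV[R]_n) : enorm u ^+ 2 = dot u u.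
Proof. by rewrite /enorm sqr_sqrtr // dot_ge0. Qed.

(** * Balls enclosing an intersection of two balls *)

(** Follows from |l u + (1 - l) w|^2 = l |u|^2 + (1 - l) |w|^2 - l (1 - l) |u - w|^2 with u = p - a
    and w = p - b. *)
Lemma sqball_convex_comb (R : realType) n (p a b : 'rV[R]_n) (l ra rb : R) :
  0 <= l <= 1 -> sqball a ra p -> sqball b rb p ->
  sqball (l *: a + (1 - l) *: b)
    (l * ra + (1 - l) * rb - l * (1 - l) * enorm (a - b) ^+ 2) p.
Proof.
move=> /andP[l0 l1]; rewrite /sqball /= !enorm_sqr => pa pb.
have -> : p - (l *: a + (1 - l) *: b) = l *: (p - a) + (1 - l) *: (p - b).
  by apply/rowP => i; rewrite !mxE; ring.
have -> : a - b = (p - b) - (p - a).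
  by apply/rowP => i; rewrite !mxE; ring.
move: (p - a) (p - b) pa pb => u w pa pb.
rewrite !dotE (dotC w u).
have := ler_wpM2l l0 pa.
have l1' : 0 <= 1 - l by rewrite subr_ge0.
have := ler_wpM2l l1' pb.
lra.
Qed.

(** Rule (1) is a convex combination of the two balls; its weights sum to 1, so the common [d]
    passes through unchanged. Rules (2) and (3) return one of the given balls. *)
Lemma sqball_enclosing_ball (R : realType) n (p a b : 'rV[R]_n)
    (ra rb d : R) :
  0 <= d -> sqball a (ra - d) p -> sqball b (rb - d) p ->
  sqball (enclosing_ball a ra b rb).1 ((enclosing_ball a ra b rb).2 - d) p.
Proof.
move=> d0 pa pb; rewrite /enclosing_ball.
case: ifPn => [/andP[rab ab]|_]; last by case: ifP.
have D0 : 0 < enorm (a - b) ^+ 2.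
  by rewrite enorm_sqr lt_neqAle dot_ge0 eq_sym dot_eq0 subr_eq0 ab.
set D := enorm (a - b) ^+ 2 in rab D0 *.
(* The weight of [a] in the center of rule (1); the condition of that rule is what places it in
   [0, 1]. *)
pose l := 2^-1 - (ra - rb) / (2 * D).
have lD : 2 * D * l = D - (ra - rb) by rewrite /l; field; exact: lt0r_neq0.
move: rab; rewrite ler_norml => /andP[rab1 rab2].
have l01 : 0 <= l <= 1 by apply/andP; split; nra.
have cE : 2^-1 *: (a + b) - ((ra - rb) / (2 * D)) *: (a - b) =
    l *: a + (1 - l) *: b.
  by apply/rowP => i; rewrite /l !mxE; field; exact: lt0r_neq0.
have rE : rb - (D + rb - ra) ^+ 2 / (4 * D) - d =
    l * (ra - d) + (1 - l) * (rb - d) - l * (1 - l) * D.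
  by rewrite /l; field; exact: lt0r_neq0.
have pab := sqball_convex_comb l01 pa pb.
by rewrite -/D -cE -rE in pab.
Qed.

Lemma enclosing_ball_radius_le (R : realType) n (a b : 'rV[R]_n)
    (G r e : R) :
  0 <= e <= 1 -> 0 <= G <= enorm (a - b) ^+ 2 -> 0 <= r ->
  (enclosing_ball a (G * (1 - e ^+ 2)) b (r - G * e ^+ 2)).2 <= (1 - e) * r.
Proof.
move=> /andP[e0 e1] /andP[G0 GD] r0; rewrite /enclosing_ball.
have e1' : 0 <= 1 - e by rewrite subr_ge0.
set D := enorm (a - b) ^+ 2 in GD *.
case: ifPn => [/andP[_ ab]|]; last rewrite negb_and => H.
  have D0 : 0 < D.
    by rewrite /D enorm_sqr lt_neqAle dot_ge0 eq_sym dot_eq0 subr_eq0 ab.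
  set ra := G * _; set rb := r - _ => /=.
  (* The radius is the minimum over l of the quadratic below; take l = e. *)
  have -> : rb - (D + rb - ra) ^+ 2 / (4 * D) =
      e * ra + (1 - e) * rb - e * (1 - e) * D
      - (2 * e * D - (D + rb - ra)) ^+ 2 / (4 * D).
    by field; exact: lt0r_neq0.
  have q0 : 0 <= (2 * e * D - (D + rb - ra)) ^+ 2 / (4 * D).
    by rewrite divr_ge0 ?sqr_ge0 // mulr_ge0 // ltW.
  have := ler_wpM2l (mulr_ge0 e0 e1') GD.
  have : e * ra + (1 - e) * rb - e * (1 - e) * G = (1 - e) * r.
    by rewrite /ra /rb; ring.
  lra.
(* Rule (2) cannot occur: the radii differ by G - r, so [DR] would give D < G - r <= G <= D. *)
case: ltP => /= [DR|RD]; first lra.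
have rhs0 := mulr_ge0 e1' r0.
(* Rule (3): equal centers force G = 0; otherwise D < r - G, hence 2 G <= r and G (1 - e^2) <= 2 (1
   - e) G <= (1 - e) r. *)
case/orP: H => [|/negPn/eqP ab]; last first.
  have D0 : D = 0 by apply/eqP; rewrite /D enorm_sqr dot_eq0 subr_eq0 ab.
  have -> : G = 0 by lra.
  by rewrite mul0r.
rewrite -ltNge lter_normr => /orP[|H]; first by lra.
have G2 : 2 * G <= r by lra.
have := ler_wpM2l e1' G2.
have := mulr_ge0 (mulr_ge0 e1' e1') G0.
lra.
Qed.

(** * Gradient steps and exact line search *)

Section SmoothStronglyConvex.
Context {R : realType} {n : nat} {alpha beta : R} {f : 'rV[R]_n -> R}.
Hypotheses (alpha_gt0 : 0 < alpha) (le_alpha_beta : alpha <= beta).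
Hypothesis f_ssc : smooth_strongly_convex alpha beta f.

Let beta_gt0 : 0 < beta. Proof. exact: lt_le_trans le_alpha_beta. Qed.

Lemma grad_step_decrease x :
  f (grad_step beta f x) <= f x - enorm (grad f x) ^+ 2 / (2 * beta).
Proof.
have [_] := f_ssc x (grad_step beta f x).
have -> : grad_step beta f x - x = - beta^-1 *: grad f x.
  by rewrite /grad_step addrAC subrr sub0r scaleNr.
rewrite !enorm_sqr !dotE => /le_trans; apply.
rewrite le_eqVlt; apply/predU1P; left; field; exact: lt0r_neq0.
Qed.

(** Completing the square in the strong convexity bound gives the squared radius |g|^2 / alpha^2 - 2
    / alpha * (f x - f y), with g the gradient at [x]. Replacing f x by the smaller value at x^+
    lowers the first term by |g|^2 / (alpha beta). *)
Lemma sqball_long_step x y :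
  sqball (grad_step alpha f x)
    (enorm (grad f x) ^+ 2 / alpha ^+ 2 * (1 - alpha / beta)
     - 2 / alpha * (f (grad_step beta f x) - f y)) y.
Proof.
have [fy _] := f_ssc x y; have fd := grad_step_decrease x.
have {}fd : f (grad_step beta f x) - f y <=
    - dot (grad f x) (y - x) - alpha / 2 * enorm (y - x) ^+ 2
    - enorm (grad f x) ^+ 2 / (2 * beta) by lra.
rewrite /sqball /grad_step /=.
have -> : y - (x - alpha^-1 *: grad f x) = (y - x) + alpha^-1 *: grad f x.
  by apply/rowP => i; rewrite !mxE; ring.
have a0 : 0 <= 2 / alpha by rewrite divr_ge0 // ltW.
have := ler_wpM2l a0 fd; rewrite -/(grad_step beta f x) -lerN2.
rewrite !enorm_sqr; move: (y - x) (grad f x) => w g.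
rewrite !dotE (dotC w g) => h.
rewrite -(lerD2l (dot g g / alpha ^+ 2 * (1 - alpha / beta))) in h.
apply: le_trans h; rewrite le_eqVlt; apply/predU1P; left; field.
by rewrite !lt0r_neq0.
Qed.

Lemma line_min_exists x y : continuous f ->
  exists z, line x y z /\ forall w, line x y w -> f z <= f w.
Proof.
move=> f_cont; pose v := y - x.
have [v0|v0] := eqVneq v 0.
  exists x; split; first by exists 0; rewrite // scale0r addr0.
  by move=> w [t _ <-]; rewrite -/v v0 scaler0 addr0.
have vv : 0 < dot v v by rewrite lt_neqAle dot_ge0 eq_sym dot_eq0 v0.
(* Strong convexity gives f (x + s v) >= f x + b s + a s^2, which is at least f x once |s| >= M; a
   minimum over [-M, M] is therefore global on the line. *)
pose a := alpha / 2 * dot v v; pose b := dot (grad f x) v; pose M := `|b| / a.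
have a0 : 0 < a by rewrite /a mulr_gt0 // divr_gt0.
have M0 : 0 <= M by rewrite divr_ge0 // ltW.
pose h t := f (x + t *: v).
have h_cont : continuous h.
  move=> t; have line_cont : x + s *: v @[s --> t] --> x + t *: v.
    by apply: cvgD; [exact: cvg_cst|apply: cvgZr_tmp; exact: cvg_id].
  exact: cvg_comp line_cont (f_cont (x + t *: v)).
have NMM : - M <= M by lra.
have [t tM ht] := EVT_min NMM (continuous_subspaceT h_cont).
exists (x + t *: v); split; first by exists t.
move=> w [s _ <-]; rewrite -/v -/(h t) -/(h s).
have [sM|sM] := leP `|s| M; first by apply: ht; rewrite in_itv /= -ler_norml.
have h0 : h t <= h 0 by apply: ht; rewrite in_itv /= oppr_le0 M0.
apply: (le_trans h0).
have [+ _] := f_ssc x (x + s *: v).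
rewrite /h scale0r addr0 [x + _ - x]addrAC subrr add0r enorm_sqr.
rewrite !dotZl !dotZr -/b; apply: le_trans; rewrite -addrA lerDl.
have bs : `|b| <= a * `|s| by rewrite -ler_pdivrMl // mulrC ltW.
have := ler_wpM2r (normr_ge0 s) bs; rewrite -normrM.
have : a * `|s| * `|s| = a * s ^+ 2.
  by rewrite -mulrA -expr2 real_normK ?num_real.
have := ler_norm (- (b * s)); rewrite normrN /a.
nra.
Qed.

Lemma line_search_min x y : continuous f ->
  line x y (line_search f x y) /\
  forall w, line x y w -> f (line_search f x y) <= f w.
Proof. by move=> f_cont; exact: getPex (line_min_exists x y f_cont). Qed.

(* Smoothness alone gives f z <= f z + s b + O(s^2) with b the slope at z, so
   a small multiple s of - b rules out b <> 0 without differentiating f. *)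
Lemma line_min_orthogonal x y z : line x y z ->
  (forall w, line x y w -> f z <= f w) -> dot (grad f z) (z - x) = 0.
Proof.
move=> [t _ zE] zmin; set v := y - x in zE.
suff gv : dot (grad f z) v = 0.
  by rewrite -{2}zE addrAC subrr add0r dotZr gv mulr0.
set b := dot (grad f z) v.
(* The summand 1 keeps this denominator positive even when [v] is zero. *)
have K0 : 0 < beta * (1 + dot v v).
  by rewrite mulr_gt0 // ltr_wpDr ?dot_ge0.
pose s := - b / (beta * (1 + dot v v)).
have bE : b = - (s * (beta * (1 + dot v v))).
  by rewrite /s divfK ?opprK // lt0r_neq0.
have fz : f z <= f (z + s *: v).
  by apply: zmin; exists (t + s); rewrite // -/v scalerDl addrA zE.
have [_] := f_ssc z (z + s *: v).
rewrite [_ + _ - z]addrAC subrr add0r enorm_sqr !dotZl !dotZr -/b.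
move=> /(le_trans fz); rewrite -addrA lerDl.
have -> : s * b + beta / 2 * (s * (s * dot v v)) =
    - (s ^+ 2 * (beta * (1 + dot v v / 2))).
  by rewrite bE; field.
rewrite oppr_ge0 pmulr_lle0; last first.
  by rewrite mulr_gt0 // ltr_wpDr // divr_ge0 ?dot_ge0.
rewrite le_eqVlt ltNge sqr_ge0 orbF sqrf_eq0 => /eqP s0.
by rewrite bE s0 mul0r oppr0.
Qed.

End SmoothStronglyConvex.

Theorem theorem1 (R : realType) (n : nat) (alpha beta kappa : R)
    (f : 'rV[R]_n -> R) (xstar x0 : 'rV[R]_n)
    (x c : nat -> 'rV[R]_n) (R2 : nat -> R)
    (alpha_gt0 : 0 < alpha) (le_alpha_beta : alpha <= beta)
    (f_diff : forall y : 'rV[R]_n, differentiable f y)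
    (f_ssc : smooth_strongly_convex alpha beta f)
    (kappaE : kappa = beta / alpha)
    (xstar_min : forall y : 'rV[R]_n, f xstar <= f y)
    (x_c_R2 : geometric_descent alpha beta f x0 x c R2) :
  forall k : nat,
    [/\ sqball (c k) (R2 k) xstar,
        R2 k.+1 <= (1 - 1 / Num.sqrt kappa) * R2 k &
        enorm (xstar - c k) ^+ 2 <= (1 - 1 / Num.sqrt kappa) ^+ k * R2 0%N].
Proof.
case: x_c_R2 => gx0 gc0 gR0 gxS gcRS.
have beta_gt0 : 0 < beta := lt_le_trans alpha_gt0 le_alpha_beta.
have f_cont : continuous f by move=> y; exact: differentiable_continuous.
set e := 1 / Num.sqrt kappa.
have kappa1 : 1 <= kappa by rewrite kappaE ler_pdivlMr // mul1r.
have sq1 : 1 <= Num.sqrt kappa by rewrite -sqrtr1 ler_wsqrtr.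
have e01 : 0 <= e <= 1.
  by rewrite /e divr_ge0 //= ler_pdivrMr ?mul1r // (lt_le_trans ltr01).
have e2 : e ^+ 2 = alpha / beta.
  rewrite /e expr_div_n sqr_sqrtr; last exact: le_trans ler01 kappa1.
  by rewrite kappaE expr1n div1r invf_div.
pose G k := enorm (grad f (x k)) ^+ 2 / alpha ^+ 2.
pose d k := 2 / alpha * (f (grad_step beta f (x k)) - f xstar).
have d_ge0 k : 0 <= d k by rewrite mulr_ge0 ?divr_ge0 ?subr_ge0 // ltW.
have G_ge0 k : 0 <= G k by rewrite divr_ge0 ?sqr_ge0.
have long_step k :
    sqball (grad_step alpha f (x k)) (G k * (1 - e ^+ 2) - d k) xstar.
  by rewrite e2; exact: sqball_long_step.
have {}gcRS k : (c k.+1, R2 k.+1) =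
    enclosing_ball (grad_step alpha f (x k.+1)) (G k.+1 * (1 - e ^+ 2))
      (c k) (R2 k - G k.+1 * e ^+ 2).
  rewrite gcRS e2 div1r invf_div /G; congr enclosing_ball; congr (_ - _).
  by field; rewrite !lt0r_neq0.
have inv k : sqball (c k) (R2 k - d k) xstar.
  elim: k => [|k IHk].
    by rewrite gc0 gR0 -gx0 mulrC div1r invf_div -e2; exact: long_step.
  have [_ zmin] :=
    line_search_min alpha_gt0 f_ssc (c k) (grad_step beta f (x k)) f_cont.
  (* Since x_k^+ lies on the searched line (at t = 1), f (x_{k+1}^+) + |g|^2 / (2 beta) <= f
     (x_{k+1}) <= f (x_k^+), with g the gradient at x_{k+1}. Scaled by 2 / alpha, this reads d_{k+1}
     + G_{k+1} e^2 <= d_k. *)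
  have old : sqball (c k) (R2 k - G k.+1 * e ^+ 2 - d k.+1) xstar.
    move: IHk; rewrite /sqball /= => /le_trans; apply.
    rewrite -!addrA lerD2l.
    have fx : f (x k.+1) <= f (grad_step beta f (x k)).
      rewrite gxS; apply: zmin; exists 1 => //.
      by rewrite scale1r addrC subrK.
    have fd := grad_step_decrease alpha_gt0 le_alpha_beta f_ssc (x k.+1).
    have fdx : f (grad_step beta f (x k.+1)) - f xstar <=
        f (grad_step beta f (x k)) - f xstar
        - enorm (grad f (x k.+1)) ^+ 2 / (2 * beta) by lra.
    have a0 : 0 <= 2 / alpha by rewrite divr_ge0 // ltW.
    have := ler_wpM2l a0 fdx; rewrite -/(d k.+1) [X in _ <= X]mulrBr -/(d k).
    have -> : 2 / alpha * (enorm (grad f (x k.+1)) ^+ 2 / (2 * beta)) =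
        G k.+1 * e ^+ 2 by rewrite e2 /G; field; rewrite !lt0r_neq0.
    lra.
  have := sqball_enclosing_ball (d_ge0 k.+1) (long_step k.+1) old.
  by rewrite -gcRS.
have R2_ge k : enorm (xstar - c k) ^+ 2 <= R2 k.
  by have := inv k; rewrite /sqball /=; have := d_ge0 k; lra.
have R2S k : R2 k.+1 <= (1 - e) * R2 k.
  have -> : R2 k.+1 = (c k.+1, R2 k.+1).2 by [].
  rewrite gcRS; apply: enclosing_ball_radius_le => //; last first.
    (* [R2 k] is nonnegative because its ball contains [xstar]. *)
    exact: le_trans (sqr_ge0 _) (R2_ge k).
  rewrite G_ge0 /=.
  have [zl zmin] :=
    line_search_min alpha_gt0 f_ssc (c k) (grad_step beta f (x k)) f_cont.
  have := line_min_orthogonal alpha_gt0 le_alpha_beta f_ssc zl zmin.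
  (* Pythagoras: with w = x_{k+1} - c_k orthogonal to g, |w - g / alpha|^2 = |w|^2 + G_{k+1}. *)
  rewrite -gxS => orth; rewrite /G !enorm_sqr /grad_step addrAC.
  move: (grad f _) (_ - c k) orth => g w orth.
  rewrite !dotE (dotC w g) orth.
  have -> : dot g g / alpha ^+ 2 = alpha^-1 * (alpha^-1 * dot g g).
    by field; exact: lt0r_neq0.
  by have := dot_ge0 w; lra.
have R2k k : R2 k <= (1 - e) ^+ k * R2 0%N.
  elim: k => [|k IHk]; first by rewrite mul1r.
  rewrite exprS -mulrA; apply: le_trans (R2S k) _.
  by rewrite ler_wpM2l // subr_ge0; case/andP: e01.
by move=> k; split => //; [exact: R2_ge|exact: le_trans (R2_ge k) (R2k k)].
Qed.
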